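(* Let $\mathcal{C}\subseteq\mathcal{T}$ be a subcategory and $\sim$ a congruence relation on $\mathcal{C}$, and assume Axioms 1, 3 and 4 below. Then the triads of any affiliation network $G$ can be partitioned into sets $S_\emptyset(G)$, $S_W(G)$, $S_X(G)$ according as they contain no wedges, exactly two open wedges, or six closed wedges, and the clustering coefficient defined by the rate-of-wedge-closure formula satisfies \[\widehat C(G)=\frac{|\mathsf{Hom}^X_{\mathcal{C}/\sim}(W,G)|}{|\mathsf{Hom}_{\mathcal{C}/\sim}(W,G)|}=\frac{3|S_X(G)|}{|S_W(G)|+3|S_X(G)|}.\] Axiom 1: $\mathcal{C}$ contains every morphism of $\mathcal{T}$ that is an injective induced graph map. Axiom 3: for every AN $G$, every triad of $G$ and every ordered triple $(i,j,k)$ of distinct actors of it, there is at most one wedge at $(i,j,k)$ (i.e. exactly one of: no wedge, one open wedge, one closed wedge). Axiom 4: for every AN $G$, if a triad of $G$ has wedges at two ordered triples with different centers, then both wedges are closed.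
   Context: An affiliation network (AN) is a finite simple undirected bipartite graph whose nodes are partitioned into actors and events, every edge joining an actor to an event. A graph map $\phi:H\to K$ sends nodes to nodes so that each edge goes to an edge; it is injective if injective on nodes and induced if its image (image nodes and image edges) is an induced subgraph of $K$. For a set $S$ of actors of $G$, the subgraph scheduled by $S$ is the subgraph induced by $S$ together with all events attended by at least two actors of $S$; a triad of $G$ is the subgraph scheduled by three actors. The category $\mathcal{T}$ has as objects triads (ANs with three actors, every event attended by at least two) and as morphisms $H\to K$ graph maps sending actors of $H$ to distinct actors of $K$ and events to events. A congruence relation on a subcategory is a family of equivalence relations on hom-sets compatible with composition. Fixed throughout: $W$ is the path $v_0v_1v_2v_3v_4$ with actors $v_0,v_2,v_4$ and events $v_1,v_3$; $X$ is the 6-cycle $v_0v_1v_2v_3v_4v_5v_0$ with actors $v_0,v_2,v_4$ and events $v_1,v_3,v_5$; $\iota:W\to X$ is $\iota(v_i)=v_i$. For an AN $G$ and $H\in\{W,X\}$, $\mathsf{Hom}_{\mathcal{C}/\sim}(H,G)$ is the set of $\sim$-classes of morphisms in $\mathcal{C}$ from $H$ to triads of $G$; $\mathsf{Hom}^X_{\mathcal{C}/\sim}(W,G)$ is the set of classes of $\phi$ with $\phi\sim\psi\circ\iota$ for some morphism $\psi$ in $\mathcal{C}$ from $X$ into a triad of $G$. Wedges are elements of $\mathsf{Hom}_{\mathcal{C}/\sim}(W,G)$, closed if in $\mathsf{Hom}^X_{\mathcal{C}/\sim}(W,G)$, open otherwise; alcoves are elements of $\mathsf{Hom}_{\mathcal{C}/\sim}(X,G)$.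 A wedge or alcove is at the ordered triple $(i,j,k)$ if it sends $v_0,v_2,v_4$ to $i,j,k$; its center is $j$. A triad contains a wedge if the wedge maps into that triad.
   Formalization: The formal theorem also assumes that equivalent morphisms from W into a triad agree on v_0, v_2, v_4, so that a wedge has a well-defined ordered triple and center; without this the claim fails, e.g. when all parallel morphisms are congruent. *)

(* Defs.v *)
(* [boolp] is used only for [`[< P >]], which turns the propositions describing
   morphisms, subcategories and congruences into booleans, so that classes of
   morphisms can be counted. *)
From HB Require Import structures.
From mathcomp Require Import all_boot all_order all_algebra.
From mathcomp Require Import boolp.

Set Implicit Arguments.
Unset Strict Implicit.
Unset Printing Implicit Defensive.

(* The nodes outside [actor] are the events.  [adj_bip] says that every edge
   joins an actor to an event; in particular there are no loops. *)
Record AN := MkAN {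
  node :> finType;
  actor : {set node};
  adj : rel node;
  adj_sym : symmetric adj;
  adj_bip : forall x y, adj x y -> (x \in actor) != (y \in actor)
}.
Arguments actor : clear implicits.
Arguments adj {_}.

Definition attendees (G : AN) (S : {set G}) (e : G) : {set G} :=
  [set a in S | adj a e].

Definition is_triad (G : AN) : Prop :=
  #|actor G| = 3 /\
  forall e : G, e \notin actor G -> 2 <= #|attendees (actor G) e|.

Record triad := MkTriad { triad_an :> AN; triadP : is_triad triad_an }.

Section InducedSubgraph.
Variables (G : AN) (U : {set G}).

Let inode : finType := {x : G | x \in U}.
Let iactor : {set inode} := [set x | val x \in actor G].
Let iadj : rel inode := fun x y => adj (val x) (val y).

Lemma iadj_sym : symmetric iadj.
Proof. by move=> x y; rewrite /iadj adj_sym. Qed.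

Lemma iadj_bip x y : iadj x y -> (x \in iactor) != (y \in iactor).
Proof. by rewrite !inE; exact: adj_bip. Qed.

Definition induced : AN := MkAN iadj_sym iadj_bip.
End InducedSubgraph.

Definition scheduled (G : AN) (S : {set G}) : {set G} :=
  S :|: [set e in ~: actor G | 2 <= #|attendees S e|].

Definition actor_triple (G : AN) : finType :=
  {S : {set G} | (S \subset actor G) && (#|S| == 3)}.

Lemma triad_of_subproof (G : AN) (S : actor_triple G) :
  is_triad (induced (scheduled (val S))).
Proof.
case: S => S /= /andP[/subsetP sSA /eqP S3].
have im (A : {set induced (scheduled S)}) (B : {set G}) :
    B \subset scheduled S -> (forall x, (x \in A) = (val x \in B)) -> #|A| = #|B|.
  move=> /subsetP sB AB; rewrite -(card_imset _ val_inj); congr #|pred_of_set _|.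
  apply/setP => x; apply/imsetP/idP => [[y + ->]|xB]; first by rewrite AB.
  by exists (Sub x (sB x xB)); rewrite ?AB SubK.
have aS x : (x \in actor (induced (scheduled S))) = (val x \in S).
  rewrite inE; have := valP x; rewrite !inE => /orP[xS|/andP[/negPf xA _]].
    by rewrite xS sSA.
  by rewrite xA; apply/esym/negP => /sSA; rewrite xA.
split=> [|e]; first by rewrite (im _ S) //; apply: subsetUl.
rewrite aS => eS; rewrite (im _ (attendees S (val e))).
- by have := valP e; rewrite !inE (negPf eS) => /andP[].
- by apply/subsetP => x; rewrite !inE => /andP[->].
- by move=> x; rewrite in_set aS [RHS]inE.
Qed.

(* The triads of [G] are indexed by their actor triples, which determine them
   and are determined by them. *)
Definition triad_of (G : AN) (S : actor_triple G) : triad :=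
  MkTriad (triad_of_subproof S).

Definition graph_map (H K : AN) (f : H -> K) : Prop :=
  forall x y, adj x y -> adj (f x) (f y).

Definition induced_map (H K : AN) (f : H -> K) : Prop :=
  forall x y, adj (f x) (f y) ->
    exists x' y', [/\ adj x' y', f x' = f x & f y' = f y].

Definition is_tmor (H K : triad) (f : H -> K) : Prop :=
  [/\ graph_map f,
      forall x, x \in actor H -> f x \in actor K,
      forall x, x \notin actor H -> f x \notin actor K
    & {in actor H &, injective f}].

Record tmor (H K : triad) := TMor {
  tmap :> {ffun H -> K};
  tmap_is_tmor : `[< is_tmor tmap >]
}.

HB.instance Definition _ (H K : triad) := [isSub for @tmap H K].
HB.instance Definition _ (H K : triad) := [Finite of tmor H K by <:].

Lemma mk_tmor_subproof (H K : triad) (f : H -> K) :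
  is_tmor f -> `[< is_tmor (finfun f : {ffun H -> K}) >].
Proof.
case=> fadj fact fev finj; apply/asboolP; split=> [x y|x|x|x y].
- by rewrite !ffunE; apply: fadj.
- by rewrite ffunE; apply: fact.
- by rewrite ffunE; apply: fev.
- by rewrite !ffunE; apply: finj.
Qed.

Definition mk_tmor (H K : triad) (f : H -> K) (fP : is_tmor f) : tmor H K :=
  TMor (mk_tmor_subproof fP).

Lemma tmorP (H K : triad) (f : tmor H K) : is_tmor f.
Proof. exact/asboolP/tmap_is_tmor. Qed.

Lemma tid_subproof (H : triad) : is_tmor (fun x : H => x).
Proof. by split. Qed.

Definition tid (H : triad) : tmor H H := mk_tmor (tid_subproof H).

Lemma tcomp_subproof (H K L : triad) (g : tmor K L) (f : tmor H K) :
  is_tmor (fun x => g (f x)).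
Proof.
have [gadj gact gev ginj] := tmorP g; have [fadj fact fev finj] := tmorP f.
split=> [x y /fadj/gadj|x /fact/gact|x /fev/gev|x y xA yA] //.
by move/(ginj _ _ (fact _ xA) (fact _ yA)); apply: finj.
Qed.

Definition tcomp (H K L : triad) (g : tmor K L) (f : tmor H K) : tmor H L :=
  mk_tmor (tcomp_subproof g f).

Record subcategory := MkSubcategory {
  ob : triad -> Prop;
  mor : forall H K : triad, tmor H K -> Prop;
  mor_dom : forall (H K : triad) (f : tmor H K), mor f -> ob H;
  mor_cod : forall (H K : triad) (f : tmor H K), mor f -> ob K;
  mor_id : forall H : triad, ob H -> mor (tid H);
  mor_comp : forall (H K L : triad) (g : tmor K L) (f : tmor H K),
    mor g -> mor f -> mor (tcomp g f)
}.
Arguments mor _ {H K}.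

(* The values of [csim] on morphisms outside [C] are irrelevant: every law, and
   every later use, is restricted to morphisms of [C]. *)
Record congruence (C : subcategory) := MkCongruence {
  csim : forall H K : triad, tmor H K -> tmor H K -> Prop;
  csim_refl : forall (H K : triad) (f : tmor H K), mor C f -> csim f f;
  csim_sym : forall (H K : triad) (f g : tmor H K),
    mor C f -> mor C g -> csim f g -> csim g f;
  csim_trans : forall (H K : triad) (f g h : tmor H K),
    mor C f -> mor C g -> mor C h -> csim f g -> csim g h -> csim f h;
  csim_comp : forall (H K L : triad) (g g' : tmor K L) (f f' : tmor H K),
    mor C g -> mor C g' -> mor C f -> mor C f' ->
    csim g g' -> csim f f' -> csim (tcomp g f) (tcomp g' f')
}.
Arguments csim {C} _ {H K}.

Definition path_adj (n : nat) : rel 'I_n :=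
  fun i j => (i.+1 == j) || (j.+1 == i).

Definition cycle_adj (n : nat) : rel 'I_n :=
  fun i j => (i.+1 == j %[mod n]) || (j.+1 == i %[mod n]).

Definition even_nodes (n : nat) : {set 'I_n} := [set i : 'I_n | ~~ odd i].

Lemma W_sym : symmetric (@path_adj 5).
Proof. by move=> x y; rewrite /path_adj orbC. Qed.

Lemma W_bip (x y : 'I_5) :
  path_adj x y -> (x \in even_nodes 5) != (y \in even_nodes 5).
Proof. by rewrite !inE => /orP[]/eqP <- /=; case: odd. Qed.

Lemma X_sym : symmetric (@cycle_adj 6).
Proof. by move=> x y; rewrite /cycle_adj orbC. Qed.

Lemma X_bip (x y : 'I_6) :
  cycle_adj x y -> (x \in even_nodes 6) != (y \in even_nodes 6).
Proof.
rewrite !inE; case: x => [[|[|[|[|[|[|//]]]]]] ?];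
  by case: y => [[|[|[|[|[|[|//]]]]]] ?].
Qed.

Lemma W_triad : is_triad (MkAN W_sym W_bip).
Proof.
split; first by rewrite -sum1dep_card big_mkcond !big_ord_recl big_ord0.
move=> e; rewrite -sum1dep_card big_mkcond !big_ord_recl big_ord0 !inE.
by case: e => [[|[|[|[|[|//]]]]] ?].
Qed.

Lemma X_triad : is_triad (MkAN X_sym X_bip).
Proof.
split; first by rewrite -sum1dep_card big_mkcond !big_ord_recl big_ord0.
move=> e; rewrite -sum1dep_card big_mkcond !big_ord_recl big_ord0 !inE.
by case: e => [[|[|[|[|[|[|//]]]]]] ?].
Qed.

(* Node [i] is v_i. *)
Definition W : triad := MkTriad W_triad.
Definition X : triad := MkTriad X_triad.

Definition v0 : W := Ordinal (isT : 0 < 5).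
Definition v2 : W := Ordinal (isT : 2 < 5).
Definition v4 : W := Ordinal (isT : 4 < 5).

Definition iota_fun (x : W) : X := widen_ord (isT : 5 <= 6) x.

Lemma iota_subproof : is_tmor iota_fun.
Proof.
split=> [x y|x|x|x y _ _ /(congr1 val) /= e]; last exact: val_inj.
- by rewrite /adj /= /path_adj /cycle_adj /= => /orP[]/eqP ->; rewrite eqxx ?orbT.
- by rewrite !inE.
- by rewrite !inE.
Qed.

Definition iotaWX : tmor W X := mk_tmor iota_subproof.

Section Wedges.
Variables (C : subcategory) (sim : congruence C).

Definition hom_class (H K : triad) (f : tmor H K) : {set tmor H K} :=
  [set g | `[< mor C g /\ csim sim f g >]].

Definition hom_classes (H K : triad) : {set {set tmor H K}} :=
  [set hom_class f | f in [set f : tmor H K | `[< mor C f >]]].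

(* A class of morphisms into a triad of [G] is paired with (the actor triple of)
   the triad it maps into, as only morphisms with equal codomains are compared. *)
Definition class_in (H : triad) (G : AN) : finType :=
  {S : actor_triple G & {set tmor H (triad_of S)}}.

Definition hom_set (H : triad) (G : AN) : {set class_in H G} :=
  [set w : class_in H G | tagged w \in hom_classes H (triad_of (tag w))].

Definition hom_setX (G : AN) : {set class_in W G} :=
  [set w in hom_set W G | `[< exists (phi : tmor W (triad_of (tag w)))
                                 (psi : tmor X (triad_of (tag w))),
     [/\ phi \in tagged w, mor C psi & csim sim phi (tcomp psi iotaWX)] >]].

Definition at_triple (G : AN) (w : class_in W G) (i j k : G) : Prop :=
  exists phi : tmor W (triad_of (tag w)),
    [/\ phi \in tagged w,
        val (phi v0) = i, val (phi v2) = j & val (phi v4) = k].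

(* [S] contains [w] when [tag w = S]. *)
Definition wedges_of (G : AN) (S : actor_triple G) : {set class_in W G} :=
  [set w in hom_set W G | tag w == S].

Definition S_empty (G : AN) : {set actor_triple G} :=
  [set S | wedges_of S == set0].

Definition S_W (G : AN) : {set actor_triple G} :=
  [set S | (#|wedges_of S| == 2) &&
           (wedges_of S \subset hom_set W G :\: hom_setX G)].

Definition S_X (G : AN) : {set actor_triple G} :=
  [set S | (#|wedges_of S| == 6) && (wedges_of S \subset hom_setX G)].

(* The value is [0] when [G] has no wedges. *)
Definition clustering (G : AN) : rat :=
  (#|hom_setX G|%:R / #|hom_set W G|%:R)%R.

(* The triple at which a wedge lies is read off a representative; this says that
   it does not depend on the representative, so that [at_triple] describes "the"
   position of a wedge and "its" center. *)
Definition position_well_defined : Prop :=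
  forall (G : AN) (w : class_in W G) (i j k i' j' k' : G),
    w \in hom_set W G -> at_triple w i j k -> at_triple w i' j' k' ->
    [/\ i = i', j = j' & k = k'].

Definition at_most_one_wedge : Prop :=
  forall (G : AN) (S : actor_triple G) (i j k : G),
    i \in val S -> j \in val S -> k \in val S -> uniq [:: i; j; k] ->
    #|[set w in wedges_of S | `[< at_triple w i j k >]]| <= 1.

Definition distinct_centers_closed : Prop :=
  forall (G : AN) (S : actor_triple G) (w w' : class_in W G)
         (i j k i' j' k' : G),
    w \in wedges_of S -> w' \in wedges_of S ->
    at_triple w i j k -> at_triple w' i' j' k' -> j != j' ->
    w \in hom_setX G /\ w' \in hom_setX G.

End Wedges.

Definition contains_injective_induced (C : subcategory) : Prop :=
  forall (H K : triad) (f : tmor H K),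
    injective f -> induced_map f -> mor C f.

(* Main.v *)
(* Automorphisms of [W] and [X] act on morphisms into a triad by
   precomposition.  The reflection of [W] turns a wedge at (i,j,k) into one at
   (k,j,i); the six automorphisms of [X] turn a closed wedge into closed wedges
   at all six orderings of the actors.  A position carries at most one wedge, so
   a closed wedge yields exactly six wedges, all closed; without closed wedges
   all wedges share a center, which leaves exactly two.  Counting wedges triad
   by triad gives the formula. *)
Require Import Defs.
From HB Require Import structures.
From mathcomp Require Import all_boot all_order all_algebra.
From mathcomp Require Import boolp.

Set Implicit Arguments.
Unset Strict Implicit.
Unset Printing Implicit Defensive.

(** * Automorphisms of the path and the hexagon as morphisms of [C] *)

Lemma can_tmor_mor (C : subcategory) (H : triad) (f g : H -> H)
    (fT : is_tmor f) :
  contains_injective_induced C -> graph_map g -> cancel f g ->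
  mor C (mk_tmor fT).
Proof.
move=> ax1 gT fK; apply: ax1 => [x y|x y].
  by rewrite !ffunE => /(can_inj fK).
(* The left inverse [g] pulls an edge between images back to an edge of [H], so [f] is induced. *)
by rewrite !ffunE => /gT; rewrite !fK => xy; exists x, y; rewrite !ffunE.
Qed.

Definition reflW_fun (x : W) : W := rev_ord (x : 'I_5).

Lemma reflW_subproof : is_tmor reflW_fun.
Proof.
split=> [||x|x y _ _ /rev_ord_inj//].
- by case=> [[|[|[|[|[|//]]]]] ?]; case=> [[|[|[|[|[|//]]]]] ?].
- by case=> [[|[|[|[|[|//]]]]] ?]; rewrite !inE.
- by case: x => [[|[|[|[|[|//]]]]] ?]; rewrite !inE.
Qed.

Definition reflW : tmor W W := mk_tmor reflW_subproof.

(** This is 4 - x modulo 6; writing 10 keeps the truncated subtraction from collapsing at x = 5. It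
    extends the reflection of [W] along [iotaWX]. *)
Definition reflX_fun (x : X) : X := Ordinal (ltn_pmod (10 - x) (isT : 0 < 6)).

Lemma reflX_funK : involutive reflX_fun.
Proof. by case=> [[|[|[|[|[|[|//]]]]]] ?]; apply: val_inj. Qed.

Lemma reflX_subproof : is_tmor reflX_fun.
Proof.
split=> [||x|x y _ _ /(can_inj reflX_funK)//].
- by case=> [[|[|[|[|[|[|//]]]]]] ?]; case=> [[|[|[|[|[|[|//]]]]]] ?].
- by case=> [[|[|[|[|[|[|//]]]]]] ?]; rewrite !inE.
- by case: x => [[|[|[|[|[|[|//]]]]]] ?]; rewrite !inE.
Qed.

Definition reflX : tmor X X := mk_tmor reflX_subproof.

(** An even shift, since actors must go to actors; it has order three, so its inverse is its
    square. *)
Definition rotX_fun (x : X) : X := Ordinal (ltn_pmod (x + 2) (isT : 0 < 6)).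

Lemma rotX_funK : cancel rotX_fun (rotX_fun \o rotX_fun).
Proof. by case=> [[|[|[|[|[|[|//]]]]]] ?]; apply: val_inj. Qed.

Lemma rotX_subproof : is_tmor rotX_fun.
Proof.
split=> [||x|x y _ _ /(can_inj rotX_funK)//].
- by case=> [[|[|[|[|[|[|//]]]]]] ?]; case=> [[|[|[|[|[|[|//]]]]]] ?].
- by case=> [[|[|[|[|[|[|//]]]]]] ?]; rewrite !inE.
- by case: x => [[|[|[|[|[|[|//]]]]]] ?]; rewrite !inE.
Qed.

Definition rotX : tmor X X := mk_tmor rotX_subproof.

Section Automorphisms.
Variable C : subcategory.
Hypothesis ax1 : contains_injective_induced C.

Lemma mor_reflW : mor C reflW.
Proof.
have [reflT _ _ _] := reflW_subproof.
exact: (can_tmor_mor _ ax1 reflT (@rev_ordK 5)).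
Qed.

Lemma mor_reflX : mor C reflX.
Proof.
have [reflT _ _ _] := reflX_subproof.
exact: (can_tmor_mor _ ax1 reflT reflX_funK).
Qed.

Lemma mor_rotX : mor C rotX.
Proof.
have [rotT _ _ _] := rotX_subproof.
by apply: (can_tmor_mor _ ax1 _ rotX_funK) => x y /rotT/rotT.
Qed.

(** [W] is [X] with the event v_5 removed: no further edge of [X] joins two of the remaining nodes,
    so [iotaWX] is induced. *)
Lemma mor_iotaWX : mor C iotaWX.
Proof.
apply: ax1 => [x y|x y]; rewrite !ffunE.
  by move=> /(congr1 val) /= /val_inj.
move=> xy; exists x, y; rewrite !ffunE; split=> //; move: xy.
by case: x => [[|[|[|[|[|//]]]]] ?]; case: y => [[|[|[|[|[|//]]]]] ?].
Qed.

End Automorphisms.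

(** * Actors of a triad of [G] *)

Lemma actor_triad_of (G : AN) (S : actor_triple G) (x : triad_of S) :
  (x \in actor (triad_of S)) = (val x \in val S).
Proof.
rewrite inE; have := valP x; have /andP[/subsetP sSA _] := valP S.
rewrite !inE => /orP[xS|/andP[/negPf xA _]]; first by rewrite xS sSA.
by rewrite xA; apply/esym/negP => /sSA; rewrite xA.
Qed.

Lemma mem_actor_triple (G : AN) (S : actor_triple G) (i j k a : G) :
    i \in val S -> j \in val S -> k \in val S -> uniq [:: i; j; k] ->
  (a \in val S) = (a \in [:: i; j; k]).
Proof.
move=> iS jS kS ijk; have /andP[_ /eqP S3] := valP S.
suff /eqP <- : [set x in [:: i; j; k]] == val S by rewrite inE.
rewrite eqEcard S3 cardsE (card_uniqP ijk) leqnn andbT.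
by apply/subsetP => x; rewrite !inE => /or3P[]/eqP ->.
Qed.

(** * Representatives and positions of wedges *)

Section Wedges.
Variables (C : subcategory) (sim : congruence C) (G : AN).
Hypothesis pos : position_well_defined sim.
Hypothesis ax1 : contains_injective_induced C.
Hypothesis ax3 : at_most_one_wedge sim.
Hypothesis ax4 : distinct_centers_closed sim.
Implicit Types (S : actor_triple G) (w : class_in W G).

Definition mor_class S (f : tmor W (triad_of S)) : class_in W G :=
  Tagged (fun S => {set tmor W (triad_of S)}) (hom_class sim f).

Lemma mor_class_wedge S (f : tmor W (triad_of S)) :
  mor C f -> mor_class f \in wedges_of sim S.
Proof.
move=> Cf; rewrite !inE eqxx andbT; apply/imsetP; exists f => //.
by rewrite inE asboolE.
Qed.

Lemma wedgeP S w :
    w \in wedges_of sim S ->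
  exists2 f : tmor W (triad_of S), mor C f & w = mor_class f.
Proof.
case: w => S' A; rewrite !inE /= => /andP[+ /eqP eS]; subst S'.
by case/imsetP => f; rewrite inE => /asboolP Cf ->; exists f.
Qed.

Lemma mem_mor_class S (f : tmor W (triad_of S)) :
  mor C f -> f \in hom_class sim f.
Proof. by move=> Cf; rewrite inE; apply/asboolP; split=> //; apply: csim_refl. Qed.

Lemma at_mor_class S (f : tmor W (triad_of S)) :
  mor C f -> at_triple (mor_class f) (val (f v0)) (val (f v2)) (val (f v4)).
Proof. by move=> Cf; exists f; split=> //; apply: mem_mor_class. Qed.

Lemma closed_mor_class S (g : tmor X (triad_of S)) :
  mor C g -> mor_class (tcomp g iotaWX) \in hom_setX sim G.
Proof.
move=> Cg; have Cgi := mor_comp Cg (mor_iotaWX ax1).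
have /setIdP[wh _] := mor_class_wedge Cgi.
rewrite inE wh; apply/asboolP; exists (tcomp g iotaWX), g.
by split=> //; [apply: mem_mor_class | apply: csim_refl].
Qed.

Lemma closed_wedgeP S w :
    w \in wedges_of sim S -> w \in hom_setX sim G ->
  exists2 g : tmor X (triad_of S), mor C g & w = mor_class (tcomp g iotaWX).
Proof.
move=> /wedgeP[f Cf ->]; rewrite inE => /andP[_ /asboolP[f' [g /= []]]].
rewrite inE => /asboolP[Cf' ff'] Cg f'g; exists g => //.
have Cgi := mor_comp Cg (mor_iotaWX ax1).
have fg := csim_trans Cf Cf' Cgi ff' f'g.
(* Equivalent morphisms have equal classes; each inclusion is an instance of transitivity. *)
congr Tagged; apply/setP => h; rewrite !inE; apply/asbool_equiv_eq.
split=> -[Ch hh]; split=> //.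
  exact: csim_trans (csim_sym Cf Cgi fg) hh.
exact: csim_trans fg hh.
Qed.

Lemma at_triple_actors S w i j k :
    w \in wedges_of sim S -> at_triple w i j k ->
  [/\ i \in val S, j \in val S, k \in val S & uniq [:: i; j; k]].
Proof.
move=> wS wijk; have [f Cf ew] := wedgeP wS; have := at_mor_class Cf.
rewrite -ew => wf; have /setIdP[wh _] := wS.
have [-> -> ->] := pos wh wijk wf.
have [_ fA _ finj] := tmorP f.
have [v0A v2A v4A] : [/\ v0 \in actor W, v2 \in actor W & v4 \in actor W].
  by rewrite !inE.
rewrite -!actor_triad_of !fA //; split=> //=.
rewrite !inE !(inj_eq val_inj) !(inj_in_eq finj) //.
Qed.

(** A functional form of [at_triple], so that wedges can be counted by their images. By [pos] the
    representative picked is immaterial; [None] arises only for an empty class, which no wedge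
    is. *)
Definition position w : option (G * G * G) :=
  omap (fun f : tmor W (triad_of (tag w)) => (val (f v0), val (f v2), val (f v4)))
       [pick f in tagged w].

Lemma positionP S w i j k :
    w \in wedges_of sim S ->
  reflect (at_triple w i j k) (position w == Some (i, j, k)).
Proof.
move=> wS; rewrite /position; case: pickP => [f fw|w0].
  apply: (iffP eqP) => [[<- <- <-]|wijk]; first by exists f.
  have /setIdP[wh _] := wS.
  have wf : at_triple w (val (f v0)) (val (f v2)) (val (f v4)) by exists f.
  by have [-> -> ->] := pos wh wijk wf.
by apply: (iffP eqP) => // -[f []]; rewrite w0.
Qed.

Lemma positionE S w : w \in wedges_of sim S ->
  exists i j k, position w = Some (i, j, k) /\ at_triple w i j k.
Proof.
move=> wS; have [f Cf ew] := wedgeP wS; have wf := at_mor_class Cf.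
rewrite -ew in wf; do 3 eexists; split; last exact: wf.
exact/eqP/(positionP _ _ _ wS).
Qed.

(** This is where [ax3] enters: ordered triples label the wedges of a triad faithfully. *)
Lemma position_inj S : {in wedges_of sim S &, injective position}.
Proof.
move=> w w' wS w'S; have [i [j [k [-> wijk]]]] := positionE wS.
move=> /esym/eqP/(positionP _ _ _ w'S) w'ijk.
have [iS jS kS ijk] := at_triple_actors wS wijk.
apply: (card_le1_eqP (ax3 iS jS kS ijk)); rewrite inE ?wS ?w'S; exact/asboolP.
Qed.

(** Since [position] is injective on the wedges of [S], counting them amounts to listing the
    occupied triples without repetition. *)
Lemma card_wedges S (s : seq (G * G * G)) : uniq s ->
    (forall i j k, (i, j, k) \in s <->
       exists2 w, w \in wedges_of sim S & at_triple w i j k) ->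
  #|wedges_of sim S| = size s.
Proof.
move=> us sP; rewrite -(card_in_imset (@position_inj S)).
rewrite -(size_map some) -(card_uniqP _);
  last by rewrite map_inj_uniq // => x y [].
apply: eq_card => p; apply/imsetP/mapP.
- move=> [w wS ->]; have [i [j [k [-> wijk]]]] := positionE wS.
  by exists (i, j, k) => //; apply/sP; exists w.
- move=> [[[i j] k] /sP[w wS wijk] ->].
  by exists w => //; apply/esym/eqP/(positionP _ _ _ wS).
Qed.

(** * Closed positions and their symmetries *)

Definition closed_at S (i j k : G) : Prop :=
  exists2 w, w \in wedges_of sim S :&: hom_setX sim G & at_triple w i j k.

Lemma closed_at_mor S (g : tmor X (triad_of S)) : mor C g ->
  closed_at S (val (g (iotaWX v0))) (val (g (iotaWX v2))) (val (g (iotaWX v4))).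
Proof.
move=> Cg; have Cgi := mor_comp Cg (mor_iotaWX ax1).
exists (mor_class (tcomp g iotaWX)).
  by rewrite inE mor_class_wedge ?closed_mor_class.
by have := at_mor_class Cgi; rewrite !ffunE.
Qed.

Lemma closed_atP S i j k : closed_at S i j k ->
  exists2 g : tmor X (triad_of S), mor C g &
    [/\ i = val (g (iotaWX v0)), j = val (g (iotaWX v2))
      & k = val (g (iotaWX v4))].
Proof.
move=> [w /setIP[wS wX] wijk]; have [g Cg ew] := closed_wedgeP wS wX.
exists g => //; have Cgi := mor_comp Cg (mor_iotaWX ax1).
have := at_mor_class Cgi; rewrite !ffunE -ew => wg.
by have /setIdP[wh _] := wS; apply: pos wh wijk wg.
Qed.

Lemma closed_at_rot S i j k : closed_at S i j k -> closed_at S j k i.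
Proof.
move=> /closed_atP[g Cg [-> -> ->]].
have := closed_at_mor (mor_comp Cg (mor_rotX ax1)); rewrite !ffunE.
(* What remains is that [rotX] carries v_0, v_2, v_4 to v_2, v_4, v_0. *)
by congr (closed_at S (val (g _)) (val (g _)) (val (g _))); apply: val_inj.
Qed.

Lemma closed_at_refl S i j k : closed_at S i j k -> closed_at S k j i.
Proof.
move=> /closed_atP[g Cg [-> -> ->]].
have := closed_at_mor (mor_comp Cg (mor_reflX ax1)); rewrite !ffunE.
by congr (closed_at S (val (g _)) (val (g _)) (val (g _))); apply: val_inj.
Qed.

Lemma wedge_at_refl S w i j k :
    w \in wedges_of sim S -> at_triple w i j k ->
  exists2 w', w' \in wedges_of sim S & at_triple w' k j i.
Proof.
move=> wS wijk; have [f Cf ew] := wedgeP wS.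
have wf := at_mor_class Cf; rewrite -ew in wf.
have /setIdP[wh _] := wS; have [-> -> ->] := pos wh wijk wf.
have Cfr := mor_comp Cf (mor_reflW ax1).
exists (mor_class (tcomp f reflW)); first exact: mor_class_wedge.
have := at_mor_class Cfr; rewrite !ffunE.
by congr (at_triple _ (val (f _)) (val (f _)) (val (f _))); apply: val_inj.
Qed.

(** * Classification of triads by their wedges *)

Lemma closed_S_X S w :
  w \in wedges_of sim S -> w \in hom_setX sim G -> S \in S_X sim G.
Proof.
move=> wS wX; have [i [j [k [_ wijk]]]] := positionE wS.
have [iS jS kS ijk] := at_triple_actors wS wijk.
have c1 : closed_at S i j k by exists w => //; rewrite inE wS.
(* [c1] to [c3] are the cyclic shifts of (i, j, k) and [c4] to [c6] their reversals: together all
   six orderings. *)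
have c2 := closed_at_rot c1; have c3 := closed_at_rot c2.
have c4 := closed_at_refl c1; have c5 := closed_at_refl c2.
have c6 := closed_at_refl c3.
pose s := [:: (i, j, k); (j, k, i); (k, i, j); (k, j, i); (i, k, j); (j, i, k)].
have sP a b c : uniq [:: a; b; c] -> a \in val S -> b \in val S -> c \in val S ->
    (a, b, c) \in s.
  rewrite !(mem_actor_triple _ iS jS kS ijk) /s !inE !xpair_eqE /=.
  (* Of the 27 choices for a, b, c, those with a repetition contradict [abc]; the other six are
     listed in [s]. *)
  by move=> abc /or3P[]/eqP ea /or3P[]/eqP eb /or3P[]/eqP ec; move: abc;
    rewrite ea eb ec !inE ?eqxx /= ?andbF ?orbT.
have sclosed a b c : (a, b, c) \in s -> closed_at S a b c.
  by rewrite !inE => /orP[|/orP[|/orP[|/orP[|/orP[]]]]] /eqP[-> -> ->].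
have us : uniq s.
  move: ijk; rewrite /s /= !inE !xpair_eqE.
  (* With the comparisons oriented alike, distinctness of the six triples is a Boolean check on
     three equality tests. *)
  rewrite (eq_sym j i) (eq_sym k i) (eq_sym k j) ?eqxx.
  by case: (i == j) (i == k) (j == k) => [] [] [].
rewrite inE (card_wedges us) => [|a b c].
  (* Any wedge [w'] shares its position with a closed wedge, hence equals it. *)
  apply/subsetP => w' w'S; have [a [b [c [pw' w'abc]]]] := positionE w'S.
  have [aS bS cS abc] := at_triple_actors w'S w'abc.
  have [w'' /setIP[w''S w''X] w''abc] := sclosed _ _ _ (sP _ _ _ abc aS bS cS).
  have /eqP pw'' := introT (positionP _ _ _ w''S) w''abc.
  by rewrite (position_inj w'S w''S) // pw' pw''.
split=> [/sclosed[w' /setIP[w'S _] w'abc]|[w' w'S w'abc]]; first by exists w'.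
by have [aS bS cS abc] := at_triple_actors w'S w'abc; apply: sP.
Qed.

Lemma open_S_W S w : w \in wedges_of sim S ->
    (forall w', w' \in wedges_of sim S -> w' \notin hom_setX sim G) ->
  S \in S_W sim G.
Proof.
move=> wS wO; have [i [j [k [_ wijk]]]] := positionE wS.
have [iS jS kS ijk] := at_triple_actors wS wijk.
have [w' w'S w'kji] := wedge_at_refl wS wijk.
rewrite inE (@card_wedges _ [:: (i, j, k); (k, j, i)]) => [||a b c].
- apply/subsetP => u uS; rewrite inE wO //.
  by move: uS; rewrite inE => /andP[].
(* The two triples differ because [i] and [k] do. *)
- rewrite /= andbT inE !xpair_eqE.
  by move: ijk; rewrite /= !inE; case: (i == k); rewrite ?orbT.
split=> [|[u uS uabc]].
  by rewrite !inE => /orP[]/eqP[-> -> ->]; [exists w | exists w'].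
have [aS bS cS abc] := at_triple_actors uS uabc.
(* A wedge [u] centered elsewhere would be closed by [ax4], contrary to [wO]. *)
have [ebj|bj] := eqVneq b j; last first.
  by have [uX _] := ax4 uS wS uabc wijk bj; rewrite (negPf (wO _ uS)) in uX.
(* With center [j], distinctness leaves only the two orders of the ends [i] and [k]. *)
move: aS cS; rewrite !(mem_actor_triple _ iS jS kS ijk) !inE !xpair_eqE.
by move=> /or3P[]/eqP ea /or3P[]/eqP ec; move: abc;
  rewrite ea ebj ec /= !inE ?eqxx /= ?andbF ?orbT.
Qed.

Lemma triad_trichotomy S :
  [\/ S \in S_empty sim G, S \in S_W sim G | S \in S_X sim G].
Proof.
have [S0|/set0Pn[w wS]] := eqVneq (wedges_of sim S) set0.
  by apply: Or31; rewrite inE S0.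
have [/existsP[w' /andP[w'S w'X]]|/existsPn nX] :=
  boolP [exists w', (w' \in wedges_of sim S) && (w' \in hom_setX sim G)].
  by apply: Or33; apply: closed_S_X w'S w'X.
by apply: Or32; apply: open_S_W wS _ => w' w'S; have := nX w'; rewrite w'S.
Qed.

End Wedges.

(** * Counting wedges triad by triad *)

Lemma card_wedges_S_empty (C : subcategory) (sim : congruence C) (G : AN)
    (S : actor_triple G) : S \in S_empty sim G -> #|wedges_of sim S| = 0.
Proof. by rewrite inE => /eqP->; rewrite cards0. Qed.

Lemma card_wedges_S_W (C : subcategory) (sim : congruence C) (G : AN)
    (S : actor_triple G) : S \in S_W sim G -> #|wedges_of sim S| = 2.
Proof. by rewrite inE => /andP[/eqP]. Qed.

Lemma card_wedges_S_X (C : subcategory) (sim : congruence C) (G : AN)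
    (S : actor_triple G) : S \in S_X sim G -> #|wedges_of sim S| = 6.
Proof. by rewrite inE => /andP[/eqP]. Qed.

(** Membership fixes the number of wedges as 0, 2 or 6, and these differ. *)
Lemma disjoint_triads (C : subcategory) (sim : congruence C) (G : AN) :
  [/\ [disjoint S_empty sim G & S_W sim G],
      [disjoint S_empty sim G & S_X sim G]
    & [disjoint S_W sim G & S_X sim G]].
Proof.
split; apply/pred0Pn => -[S /andP[]].
- by move=> /card_wedges_S_empty + /card_wedges_S_W => ->.
- by move=> /card_wedges_S_empty + /card_wedges_S_X => ->.
- by move=> /card_wedges_S_W + /card_wedges_S_X => ->.
Qed.

Lemma card_class_in (H : triad) (G : AN) (A : {set class_in H G}) :
  #|A| = \sum_(S : actor_triple G) #|[set w in A | tag w == S]|.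
Proof.
rewrite -sum1_card (partition_big (fun w : class_in H G => tag w) predT) //=.
by apply: eq_bigr => S _; rewrite -sum1dep_card.
Qed.

(** Spreads a multiple of a cardinality over all elements, so that the counts below can be compared
    triad by triad. *)
Lemma sum_mem (T : finType) (A : {set T}) (m : nat) :
  \sum_x m * (x \in A) = m * #|A|.
Proof.
by rewrite -big_distrr /= -sum1_card [in RHS]big_mkcond.
Qed.

Section Counting.
Variables (C : subcategory) (sim : congruence C) (G : AN).
Hypothesis trichotomy : forall S : actor_triple G,
  [\/ S \in S_empty sim G, S \in S_W sim G | S \in S_X sim G].

Lemma card_hom_set :
  #|hom_set sim W G| = 2 * #|S_W sim G| + 6 * #|S_X sim G|.
Proof.
have [dEW dEX dWX] := disjoint_triads sim G.
rewrite card_class_in -!sum_mem -big_split /=; apply: eq_bigr => S _.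
case: (trichotomy S) => sS.
- by rewrite (card_wedges_S_empty sS) (disjointFr dEW sS) (disjointFr dEX sS).
- by rewrite (card_wedges_S_W sS) (disjointFr dWX sS) sS.
- by rewrite (card_wedges_S_X sS) (disjointFl dWX sS) sS.
Qed.

Lemma card_hom_setX : #|hom_setX sim G| = 6 * #|S_X sim G|.
Proof.
have [_ dEX dWX] := disjoint_triads sim G.
rewrite card_class_in -sum_mem; apply: eq_bigr => S _.
(* [hom_setX] lies inside [hom_set], so its classes tagged [S] are the closed wedges of [S]. *)
have -> : [set w in hom_setX sim G | tag w == S]
        = wedges_of sim S :&: hom_setX sim G.
  by apply/setP => w; rewrite !in_set; case: (_ \in hom_classes _ _ _);
    rewrite ?andbF //= andbC.
case: (trichotomy S) => sS.
- rewrite (disjointFr dEX sS); move: sS; rewrite inE => /eqP->.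
  by rewrite set0I cards0.
- rewrite (disjointFr dWX sS); move: sS; rewrite inE => /andP[_].
  by rewrite subsetD -setI_eq0 => /andP[_ /eqP->]; rewrite cards0.
- have sub : wedges_of sim S \subset hom_setX sim G.
    by move: sS; rewrite inE => /andP[].
  by rewrite (setIidPl sub) sS (card_wedges_S_X sS).
Qed.

End Counting.

Theorem theorem2 (C : subcategory) (sim : congruence C)
    (Hpos : position_well_defined sim)
    (Hax1 : contains_injective_induced C)
    (Hax3 : at_most_one_wedge sim)
    (Hax4 : distinct_centers_closed sim)
    (G : AN) :
  [/\ S_empty sim G :|: S_W sim G :|: S_X sim G = [set: actor_triple G],
      [/\ [disjoint S_empty sim G & S_W sim G],
          [disjoint S_empty sim G & S_X sim G]
        & [disjoint S_W sim G & S_X sim G]],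
      clustering sim G = (#|hom_setX sim G|%:R / #|hom_set sim W G|%:R)%R
    & (#|hom_setX sim G|%:R / #|hom_set sim W G|%:R
       = (3 * #|S_X sim G|%:R) / (#|S_W sim G|%:R + 3 * #|S_X sim G|%:R) :> rat)%R].
Proof.
have tri := triad_trichotomy Hpos Hax1 Hax3 Hax4 (G := G).
split=> //; last 1 first.
- rewrite (card_hom_set tri) (card_hom_setX tri).
  (* Only the common factor 2, nonzero in [rat], is cancelled; so a graph without wedges, where both
     quotients are 0, needs no separate case. *)
  have -> (m n : nat) : 2 * m + 6 * n = 2 * (m + 3 * n) by rewrite mulnDr mulnA.
  have -> (n : nat) : 6 * n = 2 * (3 * n) by rewrite mulnA.
  rewrite !GRing.natrM -GRing.mulf_div GRing.divff ?GRing.mul1r.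
    by rewrite GRing.natrD GRing.natrM.
  by rewrite Num.Theory.pnatr_eq0.
- apply/setP => S; rewrite !in_setU in_setT.
  by case: (tri S) => ->; rewrite ?orbT.
- exact: disjoint_triads.
Qed.
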